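(* Fix a database $D$, a request $\rho=(s_\rho,r_\rho,\pi_\rho,q_\rho)$, a contextual-integrity policy $\mathcal P$, and its implication-completed policy $\mathcal P^{+}$. Assume every norm in $\mathcal P^{+}$ is faithfully compiled into its SQL views. Let $\llbracket\mathcal P^{+}\rrbracket_{D,\rho}$ be the set of all $(v,o)\in q_\rho(D)$ that are permitted by at least one applicable positive norm of $\mathcal P^{+}$ and prohibited by no applicable negative norm of $\mathcal P^{+}$. Then the set computed by the compiled views satisfies $$V_\rho^{\mathrm{exact}}=\mathsf{Pos}_\rho\setminus\mathsf{Viol}_\rho=\llbracket\mathcal P^{+}\rrbracket_{D,\rho};$$ equivalently, for every $(v,o)\in q_\rho(D)$, $(v,o)\in V_\rho^{\mathrm{exact}}$ if and only if $(v,o)\in\llbracket\mathcal P^{+}\rrbracket_{D,\rho}$. Consequently, releasing $V_\rho^{\mathrm{exact}}$ satisfies contextual integrity with respect to $\mathcal P$.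
   Context: A request $\rho=(s_\rho,r_\rho,\pi_\rho,q_\rho)$ consists of a sender, a recipient (querier), a declared purpose and an SQL query. Every value is tagged with its origin $o=(R,\mathit{tid},A)$ (relation, tuple identifier, attribute); $q_\rho(D)$ is the set of origin-tagged values $(v,o)$ returned by the query, so the origin attribute of each is among the attributes projected by $q_\rho$. A norm is $N_i=(\lambda_i,r_i^{\mathrm{snd}},r_i^{\mathrm{rec}},r_i^{\mathrm{sub}},\tau_i,\pi_i,\theta_i)$ with $\lambda_i\in\{+,-\}$ (positive = permits, negative = prohibits), sender, recipient and subject roles, information type $\tau_i$, purpose $\pi_i$, and condition $\theta_i$ on the sender, recipient and subject. $N_i$ applies to the flow of $(v,o)$ under $\rho$ if there is a subject $q$ such that $s_\rho$, $r_\rho$, $q$ hold the roles $r_i^{\mathrm{snd}},r_i^{\mathrm{rec}},r_i^{\mathrm{sub}}$, the purpose $\pi_\rho$ matches $\pi_i$, $\theta_i$ holds in $D$ for $(s_\rho,r_\rho,q)$, and $(v,o)$ is an origin-tagged value in $D$ of information type $\tau_i$ about $q$. An applicable positive (negative) norm permits (prohibits) $(v,o)$. A policy is a finite set of norms. $\mathcal P^{+}$ is $\mathcal P$ together with additional negative norms (prohibitions induced by information implications); its positive norms are those of $\mathcal P$. Each norm $N_i$ is compiled to views over shared variables $p_1$ (sender), $p_2$ (recipient), $q$ (subject): role views $V_i^{\mathrm{snd}}(p_1)$, $V_i^{\mathrm{rec}}(p_2)$, $V_i^{\mathrm{sub}}(q)$, a condition view $V_i^{\theta}(p_1,p_2,q)$,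 and a data view $V_i^{\mathrm{data}}(q,v,o)$. Compilation is faithful if, evaluated on $D$ with request $\rho$: the role views contain exactly the individuals holding the respective roles; $V_i^{\theta}$ holds for $(p_1,p_2,q)$ exactly when $\theta_i$ is satisfied and $\pi_\rho$ matches $\pi_i$; and $V_i^{\mathrm{data}}$ contains exactly the triples $(q,v,o)$ where $(v,o)$ is an origin-tagged value of type $\tau_i$ about $q$. Runtime evaluation: a norm is retained iff its data view governs (contains cells of) at least one attribute projected by $q_\rho$. For each retained norm the system computes $$\pi_{q,v,o}\bigl(\sigma_{p_1=s_\rho}(V_i^{\mathrm{snd}})\bowtie\sigma_{p_2=r_\rho}(V_i^{\mathrm{rec}})\bowtie V_i^{\mathrm{sub}}\bowtie V_i^{\theta}\bowtie V_i^{\mathrm{data}}\bigr).$$ $\mathsf{Pos}_\rho$ (resp. $\mathsf{Viol}_\rho$) is the set of $(v,o)\in q_\rho(D)$ appearing, for some $q$, in this result for some retained positive (resp. negative) norm of $\mathcal P^{+}$, and $V_\rho^{\mathrm{exact}}:=\mathsf{Pos}_\rho\setminus\mathsf{Viol}_\rho$. Releasing a set $S$ of origin-tagged values satisfies contextual integrity with respect to $\mathcal P$ if every element of $S$ is permitted by at least one applicable positive norm of $\mathcal P$ and prohibited by no applicable negative norm of $\mathcal P$. *)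

(* Defs.v *)
From mathcomp Require Import all_boot.
From mathcomp Require Import boolp classical_sets cardinality.

Set Implicit Arguments.
Unset Strict Implicit.
Unset Printing Implicit Defensive.

Local Open Scope classical_set_scope.

Record vocabulary := Vocabulary {
  individual : Type;
  role : Type;
  purpose : Type;
  info_type : Type;
  condition : Type;
  relname : Type;
  tupleid : Type;
  attrname : Type;
  value : Type }.

Record origin (S : vocabulary) := Origin {
  orel : relname S;
  otid : tupleid S;
  oattr : attrname S }.

(* Attributes are qualified by their relation: the column [A] of [R]. *)
Definition attribute (S : vocabulary) : Type := (relname S * attrname S)%type.

Definition attr_of {S : vocabulary} (o : origin S) : attribute S :=
  (orel o, oattr o).

Definition tagged (S : vocabulary) : Type := (value S * origin S)%type.

Record database (S : vocabulary) := Database {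
  cell : origin S -> option (value S);
  cell_finite : finite_set [set o | cell o <> None] }.

Definition tagged_in {S : vocabulary} (D : database S) : set (tagged S) :=
  [set x | cell D x.2 = Some x.1].

(* An SQL query is represented by its set of projected attributes and its
   origin-tagged answer on every database. *)
Record query (S : vocabulary) := Query {
  projected : set (attribute S);
  answer : database S -> set (tagged S);
  answer_projected : forall (D : database S) (v : value S) (o : origin S),
    answer D (v, o) -> projected (attr_of o) }.

Record request (S : vocabulary) := Request {
  sender : individual S;
  recipient : individual S;
  declared_purpose : purpose S;
  request_query : query S }.

Inductive sign := Positive | Negative.

Record norm (S : vocabulary) := Norm {
  norm_sign : sign;
  snd_role : role S;
  rec_role : role S;
  sub_role : role S;
  norm_type : info_type S;
  norm_purpose : purpose S;
  norm_cond : condition S }.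

(* The meaning of the vocabulary.  [purpose_matches pr pn]: the declared
   purpose [pr] matches the purpose [pn] of a norm.  [cond_holds D c s r q]:
   [c] holds in [D] for sender [s], recipient [r] and subject [q].
   [has_info D t q x]: [x] has information type [t] and is about [q]. *)
Record interpretation (S : vocabulary) := Interpretation {
  holds_role : database S -> individual S -> role S -> Prop;
  purpose_matches : purpose S -> purpose S -> Prop;
  cond_holds : database S -> condition S ->
    individual S -> individual S -> individual S -> Prop;
  has_info : database S -> info_type S -> individual S -> tagged S -> Prop }.

Definition applies {S : vocabulary} (I : interpretation S) (D : database S)
    (rho : request S) (N : norm S) (x : tagged S) : Prop :=
  exists q : individual S,
    [/\ holds_role I D (sender rho) (snd_role N),
        holds_role I D (recipient rho) (rec_role N)
      & holds_role I D q (sub_role N)] /\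
    [/\ purpose_matches I (declared_purpose rho) (norm_purpose N),
        cond_holds I D (norm_cond N) (sender rho) (recipient rho) q,
        tagged_in D x
      & has_info I D (norm_type N) q x].

Definition permits {S : vocabulary} (I : interpretation S) (D : database S)
    (rho : request S) (N : norm S) (x : tagged S) : Prop :=
  norm_sign N = Positive /\ applies I D rho N x.

Definition prohibits {S : vocabulary} (I : interpretation S) (D : database S)
    (rho : request S) (N : norm S) (x : tagged S) : Prop :=
  norm_sign N = Negative /\ applies I D rho N x.

Definition is_policy {S : vocabulary} (P : set (norm S)) : Prop :=
  finite_set P.

Definition is_completion {S : vocabulary} (P Pplus : set (norm S)) : Prop :=
  is_policy Pplus /\
  exists induced : set (norm S),
    (forall N, induced N -> norm_sign N = Negative) /\
    Pplus = P `|` induced.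

Definition policy_sem {S : vocabulary} (I : interpretation S)
    (D : database S) (rho : request S) (P : set (norm S)) : set (tagged S) :=
  [set x | answer (request_query rho) D x /\
     (exists N, P N /\ permits I D rho N x) /\
     ~ (exists N, P N /\ prohibits I D rho N x)].

Definition satisfies_CI {S : vocabulary} (I : interpretation S)
    (D : database S) (rho : request S) (P : set (norm S))
    (released : set (tagged S)) : Prop :=
  forall x, released x ->
    (exists N, P N /\ permits I D rho N x) /\
    ~ (exists N, P N /\ prohibits I D rho N x).

(* Relational algebra over the shared view variables. *)

Inductive var := VarP1 | VarP2 | VarQ | VarV | VarO.

Definition var_dom (S : vocabulary) (x : var) : Type :=
  match x with
  | VarP1 | VarP2 | VarQ => individual S
  | VarV => value S
  | VarO => origin S
  end.

(* The columns of a row are the variables not sent to [None]. *)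
Definition row (S : vocabulary) : Type := forall x : var, option (var_dom S x).

Definition mkrow {S : vocabulary} (p1 p2 q : option (individual S))
    (v : option (value S)) (o : option (origin S)) : row S :=
  fun x => match x return option (var_dom S x) with
           | VarP1 => p1 | VarP2 => p2 | VarQ => q | VarV => v | VarO => o
           end.

Definition compatible {S : vocabulary} (r s : row S) : Prop :=
  forall (x : var) (a b : var_dom S x), r x = Some a -> s x = Some b -> a = b.

Definition merge {S : vocabulary} (r s : row S) : row S :=
  fun x => if r x is Some a then Some a else s x.

Definition select {S : vocabulary} (x : var) (a : var_dom S x)
    (R : set (row S)) : set (row S) :=
  [set r | R r /\ r x = Some a].
Arguments select {S} x a R.

Definition njoin {S : vocabulary} (R T : set (row S)) : set (row S) :=
  [set t | exists r s, [/\ R r, T s, compatible r s & t = merge r s]].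

Definition restrict_row {S : vocabulary} (X : pred var) (r : row S) : row S :=
  fun x => if X x then r x else None.

Definition project {S : vocabulary} (X : pred var) (R : set (row S)) :
    set (row S) :=
  [set restrict_row X r | r in R].

(* A view is evaluated on a database for a given request. *)
Definition view (S : vocabulary) (T : Type) : Type :=
  database S -> request S -> set T.

Record views (S : vocabulary) := Views {
  snd_view : view S (individual S);
  rec_view : view S (individual S);
  sub_view : view S (individual S);
  cond_view : view S (individual S * individual S * individual S);
  data_view : view S (individual S * value S * origin S) }.

Definition snd_rows {S : vocabulary} (A : set (individual S)) : set (row S) :=
  [set mkrow (Some p1) None None None None | p1 in A].

Definition rec_rows {S : vocabulary} (A : set (individual S)) : set (row S) :=
  [set mkrow None (Some p2) None None None | p2 in A].

Definition sub_rows {S : vocabulary} (A : set (individual S)) : set (row S) :=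
  [set mkrow None None (Some q) None None | q in A].

Definition cond_rows {S : vocabulary}
    (A : set (individual S * individual S * individual S)) : set (row S) :=
  [set mkrow (Some t.1.1) (Some t.1.2) (Some t.2) None None | t in A].

Definition data_rows {S : vocabulary}
    (A : set (individual S * value S * origin S)) : set (row S) :=
  [set mkrow None None (Some t.1.1) (Some t.1.2) (Some t.2) | t in A].

Definition faithfully_compiled {S : vocabulary} (I : interpretation S)
    (D : database S) (rho : request S) (N : norm S) (W : views S) : Prop :=
  [/\ (forall p, snd_view W D rho p <-> holds_role I D p (snd_role N)),
      (forall p, rec_view W D rho p <-> holds_role I D p (rec_role N)),
      (forall q, sub_view W D rho q <-> holds_role I D q (sub_role N)),
      (forall p1 p2 q, cond_view W D rho (p1, p2, q) <->
         cond_holds I D (norm_cond N) p1 p2 q /\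
         purpose_matches I (declared_purpose rho) (norm_purpose N))
    & (forall q v o, data_view W D rho (q, v, o) <->
         tagged_in D (v, o) /\ has_info I D (norm_type N) q (v, o))].

Definition governs {S : vocabulary} (D : database S) (rho : request S)
    (W : views S) (A : attribute S) : Prop :=
  exists q v o, data_view W D rho (q, v, o) /\ attr_of o = A.

Definition retained {S : vocabulary} (D : database S) (rho : request S)
    (W : views S) : Prop :=
  exists A, projected (request_query rho) A /\ governs D rho W A.

Definition qvo : pred var :=
  fun x => match x with VarP1 | VarP2 => false | VarQ | VarV | VarO => true end.

Definition norm_result {S : vocabulary} (D : database S) (rho : request S)
    (W : views S) : set (row S) :=
  project qvo
    (njoin (njoin (njoin (njoin
       (select VarP1 (sender rho) (snd_rows (snd_view W D rho)))
       (select VarP2 (recipient rho) (rec_rows (rec_view W D rho))))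
       (sub_rows (sub_view W D rho)))
       (cond_rows (cond_view W D rho)))
       (data_rows (data_view W D rho))).

Definition flagged {S : vocabulary} (D : database S) (rho : request S)
    (P : set (norm S)) (W : norm S -> views S) (sg : sign) : set (tagged S) :=
  [set x | answer (request_query rho) D x /\
     exists N, [/\ P N, norm_sign N = sg, retained D rho (W N) &
       exists q, norm_result D rho (W N)
                   (mkrow None None (Some q) (Some x.1) (Some x.2))]].

Definition Pos {S : vocabulary} (D : database S) (rho : request S)
    (Pplus : set (norm S)) (W : norm S -> views S) : set (tagged S) :=
  flagged D rho Pplus W Positive.

Definition Viol {S : vocabulary} (D : database S) (rho : request S)
    (Pplus : set (norm S)) (W : norm S -> views S) : set (tagged S) :=
  flagged D rho Pplus W Negative.

Definition V_exact {S : vocabulary} (D : database S) (rho : request S)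
    (Pplus : set (norm S)) (W : norm S -> views S) : set (tagged S) :=
  Pos D rho Pplus W `\` Viol D rho Pplus W.

(* Main.v *)
Require Import Defs.
From mathcomp Require Import all_boot.
From mathcomp Require Import boolp classical_sets cardinality.

Local Open Scope classical_set_scope.

(** The natural join of the five views is a conjunction over the shared variables, and faithfulness
    turns each conjunct into a clause of [applies]; the subject left free by the projection is its
    existential witness ([norm_resultP], [norm_result_applies]). On answer cells the retention
    filter loses nothing ([applies_retained]), so [Pos] and [Viol] collect exactly the permitted and
    the prohibited answer cells, and their difference is [policy_sem]. Compliance passes from
    [Pplus] to [P] because completion adds only prohibitions. *)

Lemma norm_resultP (S : vocabulary) (D : database S) (rho : request S)
    (W : views S) (q : individual S) (v : value S) (o : origin S) :
  norm_result D rho W (mkrow None None (Some q) (Some v) (Some o)) <->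
  [/\ snd_view W D rho (sender rho), rec_view W D rho (recipient rho),
      sub_view W D rho q, cond_view W D rho (sender rho, recipient rho, q)
    & data_view W D rho (q, v, o)].
Proof.
split.
  move=> [_ [_ [_ [[_ [_ [[_ [_ [[_ [_
    [[[p1 Vp1 <-] [eqs]] [[p2 Vp2 <-] [eqr]] _ ->]]] [q1 Vq1 <-] _ ->]]]
    [[[c1 c2] q2] Vc <-] compc ->]]] [[[q3 v3] o3] Vd <-] compd ->]]] eqrow].
  (* The projected row determines only the columns q, v, o. Since [merge] keeps the left entry, its
     q column is the [q1] of the subject view; compatibility with the condition and data rows forces
     the other entries to agree. *)
  have eqq := congr1 (fun r : row S => r VarQ) eqrow.
  have [eqv] := congr1 (fun r : row S => r VarV) eqrow.
  have [eqo] := congr1 (fun r : row S => r VarO) eqrow.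
  case: eqq => eqq.
  have e1 : p1 = c1 by exact: (compc VarP1).
  have e2 : p2 = c2 by exact: (compc VarP2).
  have e3 : q1 = q2 by exact: (compc VarQ).
  have e4 : q1 = q3 by exact: (compd VarQ).
  by subst; split.
move=> [Vs Vr Vq Vc Vd].
(* Every intermediate witness is this full row cut down to the columns joined so far. *)
exists (mkrow (Some (sender rho)) (Some (recipient rho))
              (Some q) (Some v) (Some o)); last first.
  by apply: functional_extensionality_dep; case.
exists (mkrow (Some (sender rho)) (Some (recipient rho)) (Some q) None None).
exists (mkrow None None (Some q) (Some v) (Some o)); split.
- exists (mkrow (Some (sender rho)) (Some (recipient rho)) (Some q) None None).
  exists (mkrow (Some (sender rho)) (Some (recipient rho)) (Some q) None None).
  split.
  + exists (mkrow (Some (sender rho)) (Some (recipient rho)) None None None).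
    exists (mkrow None None (Some q) None None); split.
    * exists (mkrow (Some (sender rho)) None None None None).
      exists (mkrow None (Some (recipient rho)) None None None); split.
      -- by split=> //; exists (sender rho).
      -- by split=> //; exists (recipient rho).
      -- by case.
      -- by apply: functional_extensionality_dep; case.
    * by exists q.
    * by case.
    * by apply: functional_extensionality_dep; case.
  + by exists (sender rho, recipient rho, q).
  (* This join shares p1, p2 and q with its left operand, and the next one shares q; the earlier
     joins have disjoint columns. *)
  + by case=> //= a b [<-] [<-].
  + by apply: functional_extensionality_dep; case.
- by exists (q, v, o).
- by case=> //= a b [<-] [<-].
- by apply: functional_extensionality_dep; case.
Qed.

Lemma norm_result_applies (S : vocabulary) (I : interpretation S)
    (D : database S) (rho : request S) (N : norm S) (W : views S)
    (x : Defs.tagged S) :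
  faithfully_compiled I D rho N W ->
  (exists q, norm_result D rho W
               (mkrow None None (Some q) (Some x.1) (Some x.2))) <->
  applies I D rho N x.
Proof.
case: x => v o [Fs Fr Fq Fc Fd]; split=> -[q].
  move=> /norm_resultP[/Fs Hs /Fr Hr /Fq Hq /Fc[Hc Hp] /Fd[Ht Hi]].
  by exists q.
move=> [[Hs Hr Hq] [Hp Hc Ht Hi]]; exists q; apply/norm_resultP.
by split; [apply/Fs|apply/Fr|apply/Fq|apply/Fc|apply/Fd].
Qed.

(* Discarding non-retained norms is harmless: an answer cell to which a norm
   applies lies in its data view, and its attribute is projected by the query. *)
Lemma applies_retained (S : vocabulary) (I : interpretation S)
    (D : database S) (rho : request S) (N : norm S) (W : views S)
    (x : Defs.tagged S) :
  faithfully_compiled I D rho N W -> answer (request_query rho) D x ->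
  applies I D rho N x -> retained D rho W.
Proof.
case: x => v o [_ _ _ _ Fd] ans [q [_ [_ _ Ht Hi]]].
exists (attr_of o); split; first exact: answer_projected ans.
by exists q, v, o; split=> //; apply/Fd.
Qed.

Lemma flaggedP (S : vocabulary) (I : interpretation S) (D : database S)
    (rho : request S) (P : set (norm S)) (W : norm S -> views S) (sg : sign)
    (x : Defs.tagged S) :
  (forall N, P N -> faithfully_compiled I D rho N (W N)) ->
  flagged D rho P W sg x <->
  answer (request_query rho) D x /\
  exists N, P N /\ norm_sign N = sg /\ applies I D rho N x.
Proof.
move=> hW; split=> -[ans [N]].
  move=> [PN sN _ res]; split=> //; exists N; split=> //; split=> //.
  exact/(norm_result_applies _ _ _ _ _ _ _ (hW N PN)).
move=> [PN [sN app]]; split=> //; exists N; split=> //.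
  exact: applies_retained (hW N PN) ans app.
exact/(norm_result_applies _ _ _ _ _ _ _ (hW N PN)).
Qed.

Lemma V_exactE (S : vocabulary) (I : interpretation S) (D : database S)
    (rho : request S) (P : set (norm S)) (W : norm S -> views S) :
  (forall N, P N -> faithfully_compiled I D rho N (W N)) ->
  V_exact D rho P W = policy_sem I D rho P.
Proof.
move=> hW; apply/seteqP; split=> x.
  move=> [/(flaggedP _ _ _ _ _ _ _ _ hW)[ans pos] nviol].
  split=> //; split=> // viol; apply: nviol.
  exact/(flaggedP _ _ _ _ _ _ _ _ hW).
move=> [ans [pos nviol]]; split; first exact/(flaggedP _ _ _ _ _ _ _ _ hW).
by move=> /(flaggedP _ _ _ _ _ _ _ _ hW)[_ viol]; apply: nviol.
Qed.

(** A permitting norm of [Pplus] is positive, so it cannot be an induced one and lies in [P]; a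
    prohibiting norm of [P] is still present in [Pplus]. *)
Lemma policy_sem_completion_CI (S : vocabulary) (I : interpretation S)
    (D : database S) (rho : request S) (P Pplus : set (norm S)) :
  is_completion P Pplus ->
  satisfies_CI I D rho P (policy_sem I D rho Pplus).
Proof.
move=> [_ [ind [neg ->]]] x [_ [[N [PN permN]] nproh]]; split.
  exists N; split=> //; case: PN => // /neg sN.
  by case: permN; rewrite sN.
by move=> [M [PM prohM]]; apply: nproh; exists M; split=> //; left.
Qed.

Theorem theorem2 (S : vocabulary) (I : interpretation S) (D : database S)
    (rho : request S) (P Pplus : set (norm S)) (W : norm S -> views S)
    (hP : is_policy P) (hPplus : is_completion P Pplus)
    (hW : forall N : norm S, Pplus N -> faithfully_compiled I D rho N (W N)) :
  [/\ V_exact D rho Pplus W = Pos D rho Pplus W `\` Viol D rho Pplus W,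
      Pos D rho Pplus W `\` Viol D rho Pplus W = policy_sem I D rho Pplus,
      (forall (v : value S) (o : origin S),
         answer (request_query rho) D (v, o) ->
         (V_exact D rho Pplus W (v, o) <-> policy_sem I D rho Pplus (v, o)))
    & satisfies_CI I D rho P (V_exact D rho Pplus W)].
Proof.
have VE := V_exactE _ _ _ _ _ _ hW.
split=> //; first by move=> v o _; rewrite VE.
by rewrite VE; exact: policy_sem_completion_CI.
Qed.
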